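(* For $r\ge1$ let $$A_r(t)=\mathbb{H}_{P_r^A,\rho}(1,t)=\sum_{k=0}^{\lfloor r/2\rfloor}\binom{r}{2k}t^k,$$ where $P_r^A=\Phi^+(A_r)$ is the type-$A_r$ positive-root poset graded by $\rho=$ root height minus one, and set $A_0(t)=1$. Then $$\sum_{r\ge0}A_r(t)z^r=\frac{1-z}{1-2z+(1-t)z^2},$$ so that $A_1(t)=1$, $A_2(t)=1+t$, and $$A_r(t)=2A_{r-1}(t)-(1-t)A_{r-2}(t)\qquad(r\ge2).$$ Moreover, the negative zeros of $A_r$ and $A_{r+1}$ strictly interlace on $(-\infty,0)$, in the usual sense for polynomials whose degrees differ by at most one. If $\xi_{r,1},\dots,\xi_{r,d_r}$ are the zeros of $A_r$, where $d_r=\lfloor r/2\rfloor$, then for every continuous compactly supported function $f$ on $(-\infty,0)$, $$\lim_{r\to\infty}\frac1{d_r}\sum_{j=1}^{d_r}f(\xi_{r,j})=\frac1\pi\int_{-\infty}^{0}\frac{f(t)}{\sqrt{-t}\,(1-t)}\,dt.$$ When the zeros are ordered increasingly and $j_r/d_r\to u\in(0,1)$, $$\xi_{r,j_r}\longrightarrow-\cot^2\!\left(\frac{\pi u}{2}\right).$$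
   Context: $q$-Zeta numerator: let $P$ be a finite graded poset with a unique maximum and rank function $\rho:P\to\{0,\dots,H\}$, where $H$ is the maximal rank. For $m\ge 0$ put $A_m(P,\rho;q)=\sum_{x_1\le\cdots\le x_m}q^{\rho(x_1)+\cdots+\rho(x_m)}$ (sum over weak chains in $P$; $A_0(P,\rho;q)=1$). The numerator $\mathbb{H}_{P,\rho}(q,t)$ is the polynomial determined by $\sum_{m\ge 0}A_m(P,\rho;q)t^m=\mathbb{H}_{P,\rho}(q,t)/\prod_{a=0}^{H}(1-q^at)$. (The quantities $A_m(P,\rho;q)$ are unrelated to the polynomials $A_r(t)$ of the claim.) Type $A_r$: positive roots $e_i-e_{j+1}$, $1\le i\le j\le r$, simple roots $e_i-e_{i+1}$; $\alpha\le\beta$ iff $\beta-\alpha$ is a nonnegative integer combination of simple roots; height is the sum of simple-root coefficients. All zeros of $A_r$ ($r\ge2$) are real, negative and distinct, and there are $d_r=\lfloor r/2\rfloor$ of them. Strict interlacing means the zeros of the two polynomials are disjoint and, on the real line, between any two consecutive zeros of either polynomial there is exactly one zero of the other. *)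

(* Defs.v *)
From HB Require Import structures.
From mathcomp Require Import all_boot all_order all_algebra.
From mathcomp Require Import polyrcf zify.
From mathcomp Require Import all_classical all_reals all_analysis.
Set Implicit Arguments.
Unset Strict Implicit.
Unset Printing Implicit Defensive.
Import Order.TTheory GRing.Theory Num.Theory.
Import numFieldNormedType.Exports.
Local Open Scope classical_set_scope.
Local Open Scope ring_scope.

(* The formal power series \sum_n s n * z^n equals num / den in R[[z]]: den is
   invertible there iff its constant coefficient is a unit, and then the
   equation is den * s = num, coefficient by coefficient. *)
Definition fps_eq_frac (R : comUnitRingType) (s : nat -> R)
    (num den : {poly R}) : Prop :=
  den`_0 \is a GRing.unit /\
  forall n : nat, \sum_(i < n.+1) den`_i * s (n - i)%N = num`_n.

Lemma fps_eq_frac_inj (R : comUnitRingType) (s : nat -> R)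
    (num num' den : {poly R}) :
  fps_eq_frac s num den -> fps_eq_frac s num' den -> num = num'.
Proof. by move=> [_ h] [_ h']; apply/polyP => n; rewrite -h -h'. Qed.

Section QZeta.
Variables (d : Order.disp_t) (T : finPOrderType d) (rho : T -> nat).

Definition covers (x y : T) : bool :=
  (x < y)%O && [forall z, ~~ (x < z < y)%O].

Definition is_rank_function : Prop :=
  (forall x : T, (forall y, ~~ (y < x)%O) -> rho x = 0%N) /\
  (forall x y : T, covers x y -> rho y = (rho x).+1).

Definition max_rank : nat := \max_(x : T) rho x.

(* A_m as a polynomial in q *)
Definition chain_poly (m : nat) : {poly int} :=
  \sum_(x : m.-tuple T | sorted <=%O x) 'X^(\sum_(y <- x) rho y).

(* Elements of {poly {poly int}} are polynomials in t over Z[q]: the outer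
   indeterminate is t and 'X%:P is q. *)
Definition qzeta_denominator : {poly {poly int}} :=
  \prod_(a < max_rank.+1) (1 - ('X^a)%:P * 'X).

Definition is_qzeta_numerator (N : {poly {poly int}}) : Prop :=
  fps_eq_frac chain_poly N qzeta_denominator.

(* The numerator is unique by fps_eq_frac_inj; if there were none, xget would
   return 0. *)
Definition qzeta_numerator : {poly {poly int}} :=
  xget 0 [set N | is_qzeta_numerator N].

End QZeta.

Section TypeA.
Variable r : nat.

(* The pair (i, j), i <= j, of 0-based indices stands for the positive root
   e_i - e_(j+1) in Z^(r+1). *)
Record pos_root := PosRoot {
  pos_root_pair : 'I_r * 'I_r;
  _ : (pos_root_pair.1 <= pos_root_pair.2)%N
}.

HB.instance Definition _ := [isSub for pos_root_pair].
HB.instance Definition _ := [Finite of pos_root by <:].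

Implicit Types a b : pos_root.

Definition basis_vec (k : 'I_r.+1) : 'rV[int]_r.+1 := delta_mx 0 k.

Definition root_vec a : 'rV[int]_r.+1 :=
  basis_vec (widen_ord (leqnSn r) (pos_root_pair a).1)
  - basis_vec (lift ord0 (pos_root_pair a).2).

Definition simple_root (k : 'I_r) : 'rV[int]_r.+1 :=
  basis_vec (widen_ord (leqnSn r) k) - basis_vec (lift ord0 k).

(* The coordinates in the basis of simple roots; see root_vecE and
   simple_root_free. *)
Definition simple_coef a (k : 'I_r) : nat :=
  ((pos_root_pair a).1 <= k <= (pos_root_pair a).2)%N.

Definition height a : nat := \sum_k simple_coef a k.

Definition root_rank a : nat := (height a).-1.

Definition root_le a b : bool :=
  `[< exists c : 'I_r -> nat,
        root_vec b - root_vec a = \sum_k simple_root k *+ c k >].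

Lemma simple_root_partial_sum (k l : 'I_r) :
  \sum_(i < r.+1 | (i <= l)%N) simple_root k 0 i = (k == l)%:R.
Proof.
transitivity ((k <= l)%N%:R - (k < l)%N%:R : int).
  have H (m : 'I_r.+1) :
      \sum_(i < r.+1 | (i <= l)%N) basis_vec m 0 i = (m <= l)%N%:R.
    rewrite big_mkcond (bigD1 m) //= big1 ?addr0.
      by rewrite /basis_vec mxE !eqxx /=; case: ifP.
    by move=> i /negPf im; rewrite /basis_vec mxE eqxx im; case: ifP.
  rewrite -(H (widen_ord (leqnSn r) k)) -(H (lift ord0 k)) -sumrB.
  by apply: eq_bigr => i _; rewrite /simple_root !mxE.
by rewrite -val_eqE /=; case: ltngtP.
Qed.

Lemma simple_root_free (c : 'I_r -> int) :
  \sum_k c k *: simple_root k = 0 -> forall k, c k = 0.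
Proof.
move=> h l.
have : \sum_(i < r.+1 | (i <= l)%N) (\sum_k c k *: simple_root k) 0 i = 0.
  by rewrite h big1 // => i _; rewrite mxE.
under eq_bigr do rewrite summxE.
rewrite exchange_big /= (bigD1 l) //= [X in _ + X]big1 ?addr0 => [|k /negPf kl].
  under eq_bigr do rewrite mxE.
  by rewrite -mulr_sumr simple_root_partial_sum eqxx mulr1.
under eq_bigr do rewrite mxE.
by rewrite -mulr_sumr simple_root_partial_sum kl mulr0.
Qed.

Lemma root_vecE a : root_vec a = \sum_k simple_root k *+ simple_coef a k.
Proof.
case: a => -[i j] /= ij; rewrite /root_vec /simple_coef /=.
pose g (n : nat) := basis_vec (inord n).
have gE (k : 'I_r) : simple_root k = g k - g k.+1.
  by rewrite /simple_root /g; congr (basis_vec _ - basis_vec _);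
    apply: val_inj; rewrite /= inordK //; move: (ltn_ord k);
    rewrite ?ltnS // => /ltnW.
transitivity (g i - g j.+1).
  by rewrite /g; congr (basis_vec _ - basis_vec _);
    apply: val_inj; rewrite /= inordK // ltnS // ltnW.
transitivity (\sum_(k < r | (i <= k <= j)%N) (g k - g k.+1)); last first.
  rewrite big_mkcond; apply: eq_bigr => k _; rewrite gE.
  by case: ifP.
have -> : g i - g j.+1 = \sum_(i <= k < j.+1) (g k - g k.+1).
  rewrite -[LHS]opprB -(telescope_sumr g (leqW ij)) -sumrN.
  by apply: eq_bigr => k _; rewrite opprB.
rewrite -(big_mkord (fun k => (i <= k <= j)%N) (fun k => g k - g k.+1)).
rewrite (big_nat_widen i j.+1 r) ?ltn_ord // (big_nat_widenl i 0%N) //.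
by apply: eq_bigl => k; rewrite /= ltnS andbC.
Qed.

Lemma root_leP a b :
  reflect (forall k, (simple_coef a k <= simple_coef b k)%N) (root_le a b).
Proof.
apply: (iffP (asboolP _)) => [[c h] k|h].
  have /(_ k) : forall k,
      (simple_coef b k)%:Z - (simple_coef a k)%:Z - (c k)%:Z = 0.
    apply: simple_root_free.
    under eq_bigr do rewrite !scalerBl -!natz !scaler_nat.
    by rewrite !sumrB -!root_vecE h subrr.
  move=> /eqP; rewrite subr_eq0 subr_eq -PoszD => /eqP[->].
  exact: leq_addl.
exists (fun k => (simple_coef b k - simple_coef a k)%N).
rewrite !root_vecE -sumrB; apply: eq_bigr => k _.
by rewrite mulrnBr.
Qed.

Lemma root_leE a b : root_le a b =
  ((pos_root_pair b).1 <= (pos_root_pair a).1)%N &&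
  ((pos_root_pair a).2 <= (pos_root_pair b).2)%N.
Proof.
apply/root_leP/andP; case: a b => -[i j] /= ij [[k l] /= kl]; rewrite /simple_coef /=.
  move=> h; have H (m : 'I_r) : (i <= m <= j)%N -> (k <= m <= l)%N.
    by move=> e; have := h m; rewrite e; case: (k <= m <= l)%N.
  by have := H i; have := H j; rewrite !leqnn ij => /(_ isT)/andP[_ ->] /(_ isT)/andP[].
move=> [ki jl] m; case: (leqP i m) => //= im.
by rewrite (leq_trans ki im) /=; case: (leqP m j) => //= mj; rewrite (leq_trans mj jl).
Qed.

Lemma root_le_refl : reflexive root_le.
Proof. by move=> a; apply/root_leP. Qed.

Lemma root_le_anti : antisymmetric root_le.
Proof.
move=> a b; rewrite !root_leE => /andP[/andP[h1 h2] /andP[h3 h4]].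
apply: val_inj => /=; case: a b h1 h2 h3 h4 => -[i j] /= ? [[k l] /= ?] h1 h2 h3 h4.
by congr pair; apply/val_inj/eqP; rewrite eqn_leq ?h1 ?h2 ?h3 ?h4.
Qed.

Lemma root_le_trans : transitive root_le.
Proof.
move=> b a c /root_leP h1 /root_leP h2; apply/root_leP => k.
exact: leq_trans (h1 k) (h2 k).
Qed.

Fact root_display : Order.disp_t. Proof. exact: Order.Disp tt tt. Qed.

HB.instance Definition _ := Order.Le_isPOrder.Build root_display pos_root
  root_le_refl root_le_anti root_le_trans.

End TypeA.

Section TypeARank.
Variable r : nat.
Implicit Types a b : pos_root r.

Lemma heightE a :
  height a = ((pos_root_pair a).2.+1 - (pos_root_pair a).1)%N.
Proof.
case: a => -[i j] /= ij; rewrite /height /simple_coef /=.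
rewrite -(big_mkord predT (fun k => ((i <= k <= j)%N : nat))).
rewrite -[RHS]muln1 -sum_nat_const_nat.
rewrite (big_nat_widen i j.+1 r) ?ltn_ord // (big_nat_widenl i 0%N) //.
rewrite [RHS]big_mkcond; apply: eq_bigr => k _ /=.
by rewrite ltnS andbC; case: ifP.
Qed.

Lemma root_rankE a :
  root_rank a = ((pos_root_pair a).2 - (pos_root_pair a).1)%N.
Proof. by rewrite /root_rank heightE; case: a => -[i j] /= ij; rewrite subSn. Qed.

Lemma pos_root_leE a b : (a <= b)%O =
  ((pos_root_pair b).1 <= (pos_root_pair a).1)%N &&
  ((pos_root_pair a).2 <= (pos_root_pair b).2)%N.
Proof. exact: root_leE. Qed.

Lemma root_rank_is_rank_function : is_rank_function (@root_rank r).
Proof.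
have pr (k : 'I_r) : (k < r)%N := ltn_ord k.
split=> [[[i j] ij] minx|[[i j] ij] [[k l] kl]].
  have jj : (j <= j)%N by [].
  have := minx (@PosRoot r (j, j) jj).
  have := ij; rewrite lt_leAnge !pos_root_leE root_rankE /=; lia.
have := ij; have := kl.
rewrite /covers lt_leAnge !pos_root_leE !root_rankE /= => hkl hij /andP[h].
move=> /forallP cov; have [ki|ik] := ltnP k i.
  have i1r : (i.-1 < r)%N by have := pr i; lia.
  have p : (Ordinal i1r <= j)%N by rewrite /=; lia.
  have := cov (@PosRoot r (Ordinal i1r, j) p).
  by rewrite !lt_leAnge !pos_root_leE /=; lia.
have j1r : (j.+1 < r)%N by have := pr l; lia.
have p : (i <= Ordinal j1r)%N by rewrite /=; lia.
have := cov (@PosRoot r (i, Ordinal j1r) p).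
by rewrite !lt_leAnge !pos_root_leE /=; lia.
Qed.

Lemma pos_root_maximum : (0 < r)%N -> exists m, forall a, (a <= m)%O.
Proof.
move=> r0; have r1 : (r.-1 < r)%N by rewrite prednK.
exists (@PosRoot r (Ordinal r0, Ordinal r1) (leq0n _)) => -[[i j] ij].
by rewrite pos_root_leE /=; have := ltn_ord j; lia.
Qed.

End TypeARank.

Definition typeA_poly (r : nat) : {poly int} :=
  if r is 0 then 1
  else map_poly (fun p : {poly int} => p.[1]) (qzeta_numerator (@root_rank r)).

Section Zeros.
Variable R : realType.

Definition typeA_polyR (r : nat) : {poly R} := map_poly intr (typeA_poly r).

(* The j-th smallest real zero of A_r, j = 1, ..., size (rootsR (A_r)) *)
Definition xi (r j : nat) : R := (rootsR (typeA_polyR r))`_j.-1.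

Definition negative_zeros (p : {poly R}) : set R :=
  [set x | x < 0 /\ root p x].

Definition consecutive (X : set R) (a b : R) : Prop :=
  [/\ X a, X b, a < b & forall c, a < c < b -> ~ X c].

Definition strictly_interlace (X Y : set R) : Prop :=
  [/\ X `&` Y = set0,
      forall a b, consecutive X a b -> exists! c, a < c < b /\ Y c &
      forall a b, consecutive Y a b -> exists! c, a < c < b /\ X c].

Definition continuous_compact_support (I : set R) (f : R -> R) : Prop :=
  {within I, continuous f} /\
  exists K : set R, [/\ compact K, K `<=` I & forall x, I x -> ~ K x -> f x = 0].

Definition cot (x : R) : R := cos x / sin x.

End Zeros.

(* Main.v *)
(** Let [G_x(m)] be the generating polynomial of the [m]-chains below [x].
    Splitting off the top element gives
      [(1 - q^rho(x) t) G_x = 1 + t \sum_(y < x) q^rho(y) G_y],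
    so by induction on the rank the product of the [1 - q^a t], [a <= rho x],
    clears the denominator of [G_x].  At [q = 1] in type [A] the same recursion
    is a double hockey-stick sum, [G_x(m) = 'C(rho x + 2m, 2m)], and multiplying
    by [(1 - t)^r] extracts the even part of [(1 + s)^r], [t = s^2].

    The recurrence yields [A_r(- tan^2 a) = cos (r a) / cos^r a], so the zeros of
    [A_r] are the points [- tan^2 (pi v / 2)] with [v = (2 k + 1) / r < 1].
    Interlacing and quantiles then only concern these fractions, and the mean of
    [f] over the zeros is a midpoint sum for [v |-> f (- tan^2 (pi v / 2))], an
    antiderivative of which comes from the distribution function of the limit
    density by composition. *)

Require Import Defs.
From HB Require Import structures.
From mathcomp Require Import all_boot all_order all_algebra.
From mathcomp Require Import polyrcf zify ring lra.
From mathcomp Require Import all_classical all_reals all_analysis.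
Set Implicit Arguments.
Unset Strict Implicit.
Unset Printing Implicit Defensive.
Import Order.TTheory GRing.Theory Num.Theory.
Import numFieldNormedType.Exports.
Local Open Scope classical_set_scope.
Local Open Scope ring_scope.

(** * Power series and chains *)

Section PowerSeries.
Variable R : comUnitRingType.
Implicit Types (p q : {poly R}) (s : nat -> R).

(** The Cauchy product of [fps_eq_frac]; the series stays a bare sequence of coefficients. *)
Definition psmul p s n : R := \sum_(i < n.+1) p`_i * s (n - i)%N.

(** Coefficient [n] only sees the series up to order [n], so any longer truncation reduces the claim
    to polynomial multiplication. *)
Lemma psmulE p s n k : (n < k)%N -> psmul p s n = (p * \poly_(i < k) s i)`_n.
Proof.
move=> nk; rewrite coefM; apply: eq_bigr => i _; rewrite coef_poly.
by rewrite (leq_ltn_trans (leq_subr _ _) nk).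
Qed.

Lemma eq_psmul p s s' : s =1 s' -> psmul p s =1 psmul p s'.
Proof. by move=> e n; apply: eq_bigr => i _; rewrite e. Qed.

Lemma psmul_coef p q n : psmul p (fun i => q`_i) n = (p * q)`_n.
Proof. by rewrite coefM. Qed.

Lemma psmulA p q s n : psmul p (psmul q s) n = psmul (p * q) s n.
Proof.
rewrite [RHS](psmulE _ _ (ltnSn n)) -mulrA coefM; apply: eq_bigr => i _.
by rewrite (psmulE _ _ (_ : _ < n.+1)%N) // ltnS leq_subr.
Qed.

Lemma psmul_sum (I : finType) (P : pred I) p (F : I -> nat -> R) n :
  psmul p (fun m => \sum_(i | P i) F i m) n = \sum_(i | P i) psmul p (F i) n.
Proof.
by rewrite exchange_big; apply: eq_bigr => i _; rewrite mulr_sumr.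
Qed.

Lemma psmul_1BCX (c : R) s n :
  psmul (1 - c%:P * 'X) s n = s n - c * (if n is m.+1 then s m else 0).
Proof.
rewrite (psmulE _ _ (ltnSn n)) mulrBl mul1r coefB coef_poly ltnSn.
congr (_ - _); rewrite -mulrA coefCM coefXM.
by case: n => // n; rewrite coef_poly ltnW.
Qed.

Lemma psmulX s n : psmul 'X s n = if n is m.+1 then s m else 0.
Proof.
rewrite (psmulE _ _ (ltnSn n)) coefXM.
by case: n => // n; rewrite coef_poly ltnW.
Qed.

Lemma psmulD p s s' n :
  psmul p (fun m => s m + s' m) n = psmul p s n + psmul p s' n.
Proof. by rewrite -big_split; apply: eq_bigr => i _; rewrite mulrDr. Qed.

Lemma psmulZ p (c : R) s n : psmul p (fun m => c * s m) n = c * psmul p s n.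
Proof. by rewrite mulr_sumr; apply: eq_bigr => i _; rewrite mulrCA. Qed.

(** The polynomial [q] clears the denominator of the series; it need not be the least one that
    does. *)
Definition rational_with (q : {poly R}) s : Prop :=
  exists p : {poly R}, forall n, psmul q s n = p`_n.

Lemma rational_withM p q s : rational_with q s -> rational_with (p * q) s.
Proof.
move=> [p' h]; exists (p * p') => n.
by rewrite -psmulA (eq_psmul _ h) psmul_coef.
Qed.

Lemma rational_withZ (c : R) q s :
  rational_with q s -> rational_with q (fun m => c * s m).
Proof. by move=> [p h]; exists (c%:P * p) => n; rewrite psmulZ h coefCM. Qed.

Lemma rational_with_sum (I : finType) (P : pred I) q (F : I -> nat -> R) :
  (forall i, P i -> rational_with q (F i)) ->
  rational_with q (fun m => \sum_(i | P i) F i m).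
Proof.
(* With [P i] moved under the existential, numerators can be chosen for all indices at once; 0
   serves outside [P]. *)
move=> h; have /(_ _)/cid-H i : exists p : {poly R},
    P i -> forall n, psmul q (F i) n = p`_n.
  by case: (boolP (P i)) => [/h[p hp]|]; [exists p | exists 0].
exists (\sum_(i | P i) sval (H i)) => n; rewrite psmul_sum coef_sum.
by apply: eq_bigr => i Pi; rewrite (svalP (H i) Pi).
Qed.

End PowerSeries.

(** * Chains below an element and existence of the numerator *)

Section Chains.
Variables (d : Order.disp_t) (T : finPOrderType d) (rho : T -> nat).

(** The tuples run downwards from [x], so that removing the head removes the top element of the
    chain. *)
Definition chains_below (x : T) (m : nat) : {poly int} :=
  \sum_(t : m.-tuple T | path >=%O x t) 'X^(\sum_(y <- t) rho y).

Lemma chains_below0 x : chains_below x 0 = 1.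
Proof.
rewrite /chains_below (bigD1 [tuple]) //= big_nil expr0 big1 ?addr0 //.
by move=> t /andP[_]; rewrite tuple0.
Qed.

Lemma chains_belowS x m :
  chains_below x m.+1 = \sum_(y | (y <= x)%O) 'X^(rho y) * chains_below y m.
Proof.
under eq_bigr do rewrite /chains_below mulr_sumr.
rewrite pair_big_dep /=.
rewrite /chains_below.
rewrite (reindex (fun p : T * m.-tuple T => [tuple of p.1 :: p.2])) /=; last first.
  exists (fun t => (thead t, [tuple of behead t])) => [[y t] _|t _] /=.
    by rewrite theadE; congr pair; apply: val_inj.
  by rewrite [RHS]tuple_eta.
by apply: eq_bigr => p _; rewrite big_cons exprD.
Qed.

(** Reversing a chain makes it decreasing, and the bound by a maximum is automatic. *)
Lemma chain_poly_max (x : T) :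
  (forall y, y <= x)%O -> chain_poly rho =1 chains_below x.
Proof.
move=> xmax m; rewrite /chain_poly.
have revK' : involutive (fun t : m.-tuple T => [tuple of rev t]).
  by move=> t; apply: val_inj; rewrite /= revK.
rewrite (reindex_inj (inv_inj revK')) /=.
apply: eq_big => [t|t _]; last by rewrite big_rev.
rewrite rev_sorted; case: t => -[|y t] //= _.
by rewrite xmax.
Qed.

Hypothesis rho_lt : {homo rho : y z / (y < z)%O >-> (y < z)%N}.

(** The factor on the left removes the chains whose top element is [x] itself. *)
Lemma psmul_chains_below (x : T) (n : nat) :
  psmul (1 - ('X^(rho x))%:P * 'X) (chains_below x) n =
  (1 : {poly {poly int}})`_n +
  psmul 'X (fun m => \sum_(y | (y < x)%O) 'X^(rho y) * chains_below y m) n.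
Proof.
rewrite psmul_1BCX psmulX coef1; case: n => [|n].
  by rewrite mulr0 subr0 addr0 chains_below0.
rewrite add0r chains_belowS (bigD1 x) //= addrAC subrr add0r.
by apply: eq_bigl => y; rewrite lt_neqAle andbC.
Qed.

(** Strong induction on the rank: every [y < x] has smaller rank, so its denominator divides the
    product [Q] over [a < rho x]. *)
Lemma rational_chains_below (x : T) :
  rational_with (\prod_(a < (rho x).+1) (1 - ('X^a)%:P * 'X)) (chains_below x).
Proof.
have [k] := ubnP (rho x); elim: k x => // k IH x; rewrite ltnS => xk.
rewrite big_ord_recr /=; set Q := \prod_(_ < _) _.
have [N hN] : rational_with Q
    (fun m => \sum_(y | (y < x)%O) 'X^(rho y) * chains_below y m).
  apply: rational_with_sum => y yx; apply: rational_withZ.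
  have /subnKC := rho_lt yx; rewrite /Q => <-; rewrite big_split_ord /= mulrC.
  by apply/rational_withM/IH/(leq_trans (rho_lt yx)).
exists (Q + 'X * N) => n.
rewrite -psmulA (eq_psmul _ (psmul_chains_below x)) psmulD psmul_coef mulr1.
by rewrite psmulA mulrC -psmulA (eq_psmul _ hN) psmul_coef coefD.
Qed.

Lemma max_rank_maximum (x : T) : (forall y, y <= x)%O -> max_rank rho = rho x.
Proof.
move=> xmax; apply/eqP; rewrite eqn_leq leq_bigmax andbT.
apply/bigmax_leqP => y _.
by have := xmax y; rewrite le_eqVlt => /predU1P[->//|/rho_lt/ltnW].
Qed.

Lemma qzeta_numeratorP (x : T) : (forall y, y <= x)%O ->
  is_qzeta_numerator rho (qzeta_numerator rho).
Proof.
move=> xmax; have rmax := max_rank_maximum xmax.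
have [N hN] := rational_chains_below x.
(* [xget] returns a numerator as soon as one exists. *)
apply: (@xgetPex _ 0 [set N | is_qzeta_numerator rho N]); exists N; split.
  rewrite /qzeta_denominator -horner_coef0 horner_prod.
  rewrite big1 ?unitr1 // => a _.
  by rewrite !hornerE subr0.
move=> n; rewrite -hN /qzeta_denominator rmax; apply: eq_bigr => i _.
by rewrite (chain_poly_max xmax).
Qed.

End Chains.

(** * The numerator in type A *)

Lemma hockey_stick (p n : nat) : \sum_(0 <= i < n) 'C(i + p, p) = 'C(n + p, p.+1).
Proof.
elim: n => [|n IH]; first by rewrite big_geq // bin_small.
by rewrite big_nat_recr //= IH addSn binS.
Qed.

(** Each of the two summations is a hockey stick and raises the lower index by one. *)
Lemma hockey_stick_pairs (p i j : nat) : (i <= j)%N ->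
  \sum_(i <= k < j.+1) \sum_(k <= l < j.+1) 'C(l - k + p, p)
  = 'C(j - i + p.+2, p.+2).
Proof.
move=> ij.
have inner k : \sum_(k <= l < j.+1) 'C(l - k + p, p) = 'C(j.+1 - k + p, p.+1).
  rewrite -hockey_stick -[X in \sum_(X <= _ < _) _]add0n big_addn.
  by apply: eq_bigr => l _; rewrite addnK.
under eq_bigr do rewrite inner.
(* After reversal and a shift the binomials appear in increasing order, starting from index 0. *)
rewrite big_nat_rev /= -[X in \sum_(X <= _ < _) _]add0n big_addn.
have -> : (j - i + p.+2 = (j.+1 - i) + p.+1)%N by lia.
rewrite -hockey_stick.
rewrite [LHS]big_nat [RHS]big_nat; apply: eq_bigr => k /andP[_ kj].
by congr 'C(_, _); lia.
Qed.

Lemma sum_ord_itv (r a b : nat) (F : nat -> nat) : (b < r)%N ->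
  \sum_(l < r | (a <= l <= b)%N) F l = \sum_(a <= l < b.+1) F l.
Proof.
move=> br; rewrite -(big_mkord (fun l => (a <= l <= b)%N) F).
rewrite (big_nat_widen a b.+1 r) // (big_nat_widenl a 0%N) //.
by apply: eq_bigl => k; rewrite /= ltnS andbC.
Qed.

(** The roots below the one of $[i, j]$ are the subintervals $[k, l]$, of rank $l - k$, which makes
    this a double hockey stick. *)
Lemma sum_below_root (r p : nat) (x : pos_root r) :
  \sum_(y : pos_root r | (y <= x)%O) 'C(root_rank y + p, p)
  = 'C(root_rank x + p.+2, p.+2).
Proof.
case: x => -[i j] /= ij; set x := @PosRoot r (i, j) ij.
transitivity (\sum_(q : 'I_r * 'I_r | [&& q.1 <= q.2, i <= q.1 & q.2 <= j]%N)
   'C(q.2 - q.1 + p, p)).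
  (* The default [x] of [insubd] is never taken, since only pairs with [q.1 <= q.2] are summed. *)
  rewrite (reindex_onto val (insubd x)) /=; last first.
    by move=> q /andP[q12 _]; rewrite insubdK.
  apply: eq_big => [y|y _]; last by rewrite root_rankE.
  rewrite valKd eqxx andbT pos_root_leE /=.
  by rewrite (valP y).
rewrite root_rankE /= -hockey_stick_pairs // -(sum_ord_itv _ _ (ltn_ord j)).
under [RHS]eq_bigr do rewrite -(sum_ord_itv _ _ (ltn_ord j)).
rewrite pair_big_dep /=; apply: eq_bigl => -[k l] /=.
by lia.
Qed.

(** One more chain element is one more use of [sum_below_root], which raises the lower index by
    two. *)
Lemma horner1_chains_below (r m : nat) (x : pos_root r) :
  (chains_below (@root_rank r) x m).[1] = 'C(root_rank x + 2 * m, 2 * m)%:R.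
Proof.
elim: m x => [|m IH] x.
  by rewrite muln0 addn0 bin0 chains_below0 hornerC.
rewrite chains_belowS horner_sum.
under eq_bigr do rewrite hornerM hornerXn expr1n mul1r IH.
by rewrite -natr_sum sum_below_root mulnS.
Qed.

Lemma root_rank_lt (r : nat) :
  {homo @root_rank r : y z / (y < z)%O >-> (y < z)%N}.
Proof.
move=> -[[i j] ij] [[k l] kl]; rewrite lt_leAnge !pos_root_leE !root_rankE /=.
by move: ij kl => /=; lia.
Qed.

Definition bin_even (r : nat) : {poly int} :=
  \sum_(0 <= k < (r./2).+1) 'C(r, 2 * k)%:R *: 'X^k.

Lemma coef_bin_even (r n : nat) : (bin_even r)`_n = 'C(r, 2 * n)%:R.
Proof.
rewrite /bin_even big_mkord -(poly_def _ (fun k => 'C(r, 2 * k)%:R)) coef_poly.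
by case: ltnP => // h; rewrite bin_small //; lia.
Qed.

(* The odd part of [(1 + s)^r] has to be carried along in the induction. *)
Lemma psmul_bin (r n : nat) :
  psmul ((1 - 'X) ^+ r.+1) (fun m => 'C(r + 2 * m, 2 * m)%:R : int) n
    = 'C(r.+1, 2 * n)%:R /\
  psmul ((1 - 'X) ^+ r.+1) (fun m => 'C(r + 2 * m + 1, 2 * m + 1)%:R : int) n
    = 'C(r.+1, 2 * n + 1)%:R.
Proof.
have one_sub s m :
    psmul (1 - 'X) s m = s m - (if m is m'.+1 then s m' else 0) :> int.
  by rewrite -['X]mul1r -[1]/(1%:P) psmul_1BCX mul1r.
elim: r n => [|r IH] n.
  rewrite expr1 !one_sub; case: n => [|n]; first by [].
  by rewrite !add0n !binn !subrr !bin_small //; lia.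
(* With $t = s^2$, [S r] and [O r] are the even and odd parts of $(1-s)^{-(r+1)}$, and [sh] is
   multiplication by $t$; Pascal's rule is division by $1-s$. *)
pose S r m : int := 'C(r + 2 * m, 2 * m)%:R.
pose O r m : int := 'C(r + 2 * m + 1, 2 * m + 1)%:R.
pose sh (s : nat -> int) m := if m is m'.+1 then s m' else 0.
have SE m : S r.+1 m = S r m + sh (O r.+1) m.
  rewrite /S /O; case: m => [|m] /=; first by rewrite !muln0 !bin0.
  rewrite -natrD mulnS -[(2 + _)%N]/((2 * m).+1.+1) addSn binS.
  by congr (_%:R); congr (_ + 'C(_, _))%N; lia.
have OE m : O r.+1 m = O r m + S r.+1 m.
  by rewrite /S /O -natrD !addn1 binS addSn.
rewrite exprSr -!psmulA.
(* Since $1 - t = (1-s)(1+s)$, order $r+1$ falls back to order $r$ times $1+s$, split into its even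
   and odd parts. *)
have e1 m : psmul (1 - 'X) (S r.+1) m = S r m + psmul 'X (O r) m.
  rewrite one_sub SE psmulX; case: m => [|m] /=; first by ring.
  by rewrite OE; ring.
have e2 m : psmul (1 - 'X) (O r.+1) m = O r m + S r m.
  by rewrite one_sub OE SE; case: m => [|m] /=; ring.
rewrite (eq_psmul _ e1) (eq_psmul _ e2) !psmulD psmulA mulrC -psmulA psmulX.
rewrite (IH n).1 (IH n).2; split.
  case: n => [|n]; first by rewrite !muln0 !bin0 addr0.
  by rewrite (IH n).2 -natrD mulnS -[(2 + _)%N]/((2 * n).+1.+1) addn1 [in RHS]binS.
by rewrite -natrD addn1 [in RHS]binS.
Qed.

Lemma typeA_polyE (r : nat) : (1 <= r)%N ->
  is_qzeta_numerator (@root_rank r) (qzeta_numerator (@root_rank r)) /\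
  typeA_poly r = bin_even r.
Proof.
move=> r0; have [x xmax] := pos_root_maximum r0.
have num := qzeta_numeratorP (@root_rank_lt r) xmax; split=> //.
(* The maximum is the highest root, given by the pair $(0, r-1)$. *)
have rx : root_rank x = r.-1.
  apply/eqP; rewrite eqn_leq root_rankE; apply/andP; split.
    by have := ltn_ord (pos_root_pair x).2; lia.
  have p0 : (Ordinal r0 <= rev_ord (Ordinal r0))%N by [].
  have := xmax (@PosRoot r (_, _) p0); rewrite pos_root_leE /=; lia.
have mrx : max_rank (@root_rank r) = r.-1.
  by rewrite (max_rank_maximum (@root_rank_lt r) xmax).
apply/polyP => n; rewrite coef_bin_even.
case: r r0 x xmax num rx mrx => // r _ x xmax [_ num] rx mrx.
rewrite /typeA_poly coef_map_id0 ?horner0 // -num horner_sum.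
rewrite -(psmul_bin r n).1; apply: eq_bigr => i _.
rewrite hornerM (chain_poly_max _ xmax) horner1_chains_below rx.
congr (_ * _).
(* At $q = 1$ every factor of the denominator becomes $1 - t$. *)
transitivity ((map_poly (horner_eval (1 : int))
    (qzeta_denominator (@root_rank r.+1)))`_i); first by rewrite coef_map.
rewrite /qzeta_denominator mrx rmorph_prod /=.
under eq_bigr do rewrite rmorphB rmorphM /= rmorph1 map_polyX map_polyC /=
  /horner_eval hornerXn expr1n mul1r.
by rewrite big_const_ord iter_mulr_1.
Qed.

Local Arguments typeA_poly : simpl never.

Lemma typeA_poly_bin_even (r : nat) : typeA_poly r = bin_even r.
Proof.
case: r => [|r]; last by rewrite (typeA_polyE (ltn0Sn r)).2.
by rewrite /bin_even big_nat1 bin0 scale1r expr0.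
Qed.

(** * Recurrence and generating function *)

Lemma typeA_poly0 : typeA_poly 0 = 1. Proof. by []. Qed.

Lemma typeA_poly1 : typeA_poly 1 = 1.
Proof. by rewrite typeA_poly_bin_even /bin_even big_nat1 bin0 scale1r expr0. Qed.

(** Repeated use of Pascal's rule in each coefficient. *)
Lemma typeA_polySS (r : nat) :
  typeA_poly r.+2 = 2%:R *: typeA_poly r.+1 - (1 - 'X) * typeA_poly r.
Proof.
rewrite !typeA_poly_bin_even; apply/polyP => n.
rewrite mulrBl mul1r !coefB coefZ coefXM !coef_bin_even.
case: n => [|n] /=; first by rewrite !muln0 !bin0 subr0.
rewrite mulnS -[(2 + _)%N]/((2 * n).+2) !binS !natrD.
by ring.
Qed.

Lemma typeA_poly2 : typeA_poly 2 = 1 + 'X.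
Proof.
rewrite typeA_polySS typeA_poly0 typeA_poly1 scaler_nat mulr1.
by ring.
Qed.

(** The outer ['X] is $z$, while the ['X] in the scalar [1 - 'X] is $t$. From degree 2 on the claim
    is the recurrence; degrees 0 and 1 give the numerator. *)
Lemma typeA_poly_gf :
  fps_eq_frac typeA_poly (1 - 'X) (1 - 2%:R *: 'X + (1 - 'X) *: 'X^2).
Proof.
set den := 1 - _ + _.
have den_coef i : den`_i = (i == 0%N)%:R - 2%:R * (i == 1%N)%:R + (1 - 'X) * (i == 2)%:R.
  by rewrite /den coefD coefB coef1 !coefZ coefX coefXn.
split; first by rewrite den_coef !mulr0 subr0 addr0 unitr1.
case=> [|[|n]].
- by rewrite big_ord1 den_coef !mulr0 subr0 addr0 mul1r coefB coef1 coefX subr0.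
- rewrite 2!big_ord_recl big_ord0 /= /bump /= subn0 subnn !den_coef /= typeA_poly1 typeA_poly0.
  by rewrite coefB coef1 coefX /=; ring.
rewrite 3!big_ord_recl big1 => [|i _]; last first.
  by rewrite den_coef /= /bump /= !mulr0 subr0 addr0 mul0r.
rewrite !den_coef /= /bump /= !subn0 !subSS !subn0 typeA_polySS coefB coef1 coefX /=.
by rewrite -mul_polyC; ring.
Qed.

(** * Zeros, interlacing and quantiles *)

Section Zeros.
Variable R : realType.
Implicit Types (r : nat) (u v w x : R).

(** A decreasing parametrization of $(-\infty, 0]$ by $v \in [0, 1)$, under which the zeros become
    equally spaced fractions. *)
Definition ntan2 v : R := - tan (pi / 2 * v) ^+ 2.

Lemma halfpi_itv v : -1 < v < 1 -> - (pi / 2) < pi / 2 * v < pi / 2.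
Proof.
have h := @pi_gt0 R; move=> /andP[v0 v1].
by rewrite -mulrN1 ltr_pM2l ?gtr_pMr ?v0 //; lra.
Qed.

Lemma cos_halfpi_gt0 v : -1 < v < 1 -> 0 < cos (pi / 2 * v).
Proof. by move=> /halfpi_itv/cos_gt0_pihalf. Qed.

Lemma tan_halfpi_lt u v : -1 < u -> u < v -> v < 1 ->
  tan (pi / 2 * u) < tan (pi / 2 * v).
Proof.
move=> u0 uv v1; rewrite ltr_tan ?in_itv /= ?halfpi_itv //; last 2 first.
- by rewrite u0 (lt_trans uv).
- by rewrite v1 (lt_trans u0).
by rewrite ltr_pM2l // divr_gt0 ?pi_gt0.
Qed.

Lemma tan_halfpi_ge0 v : 0 <= v < 1 -> 0 <= tan (pi / 2 * v).
Proof.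
rewrite le_eqVlt => /andP[/predU1P[<- _|v0 v1]]; first by rewrite mulr0 tan0.
by rewrite -[leLHS](tan0 R) -[X in tan X](mulr0 (pi / 2)) ltW // tan_halfpi_lt //; lra.
Qed.

Lemma ntan2_lt u v : 0 <= u -> u < v -> v < 1 -> ntan2 v < ntan2 u.
Proof.
move=> u0 uv v1; have tu : 0 <= tan (pi / 2 * u).
  by rewrite tan_halfpi_ge0 // u0 (lt_trans uv).
have tuv : tan (pi / 2 * u) < tan (pi / 2 * v) by apply: tan_halfpi_lt; lra.
by rewrite ltrN2 ltr_pXn2r // nnegrE // (le_trans tu) // ltW.
Qed.

Lemma ntan2_lt0 v : 0 < v < 1 -> ntan2 v < 0.
Proof.
move=> /andP[v0 v1]; have := ntan2_lt (lexx 0) v0 v1.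
by rewrite {2}/ntan2 mulr0 tan0 expr0n oppr0.
Qed.

Lemma ntan2_ltE u v : 0 <= u < 1 -> 0 <= v < 1 -> (ntan2 u < ntan2 v) = (v < u).
Proof.
move=> /andP[u0 u1] /andP[v0 v1]; have [uv|vu|->] := ltgtP u v.
- by rewrite ltNge ltW // ntan2_lt.
- by rewrite ntan2_lt.
- by rewrite ltxx.
Qed.

(** At $t = -\tan^2 x$ one has $1 - t = 1/\cos^2 x$, and the recurrence becomes $\cos (r+2)x = 2
    \cos x \cos (r+1)x - \cos rx$. *)
Lemma horner_typeA_polyR r x : cos x != 0 ->
  (typeA_polyR R r).[- tan x ^+ 2] = cos (r%:R * x) / cos x ^+ r.
Proof.
move=> cx; have [k] := ubnP r; elim: k r => // k IH [|[|r]] rk.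
- by rewrite /typeA_polyR typeA_poly0 rmorph1 hornerC mul0r cos0 divr1.
- by rewrite /typeA_polyR typeA_poly1 rmorph1 hornerC mul1r divff.
have := IH r.+1; have := IH r; rewrite /typeA_polyR typeA_polySS => h1 h2.
rewrite rmorphB rmorphM rmorphB /= rmorph1 map_polyX map_polyZ /= !hornerE.
rewrite h1 ?h2; try lia.
have two : (2 : int)%:~R = 2 :> R by [].
rewrite opprK -cos2_tan2 // two.
have -> : r.+2%:R * x = r.+1%:R * x + x by rewrite -[r.+2]addn1 natrD mulrDl mul1r.
have -> : r%:R * x = r.+1%:R * x - x by rewrite -[r.+1]addn1 natrD mulrDl mul1r addrK.
rewrite cosB cosD !exprS.
by field; rewrite cx expf_neq0.
Qed.

Lemma cos_odd_halfpi (k : nat) : cos ((2 * k + 1)%:R * (pi / 2)) = 0 :> R.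
Proof.
elim: k => [|k IH]; first by rewrite mul1r cos_pihalf.
have -> : (2 * k.+1 + 1)%:R * (pi / 2) = (2 * k + 1)%:R * (pi / 2) + pi :> R.
  by rewrite mulnS -addnA natrD; field.
by rewrite cosDpi IH oppr0.
Qed.

Definition fracn (m r : nat) : R := m%:R / r%:R.

Lemma fracn_itv (m r : nat) : (0 < m < r)%N -> 0 < fracn m r < 1.
Proof.
move=> /andP[m0 mr]; have r0 := ltn_trans m0 mr.
by rewrite divr_gt0 ?ltr0n // ltr_pdivrMr ?ltr0n // mul1r ltr_nat.
Qed.

Lemma fracn_itvW (m r : nat) : (m < r)%N -> 0 <= fracn m r < 1.
Proof.
move=> mr; rewrite divr_ge0 ?ler0n // ltr_pdivrMr ?ltr0n ?mul1r ?ltr_nat //.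
exact: leq_ltn_trans mr.
Qed.

Lemma fracn_lt (m n r s : nat) : (0 < r)%N -> (0 < s)%N ->
  (fracn m r < fracn n s) = (m * s < n * r)%N.
Proof.
move=> r0 s0; rewrite ltr_pdivrMr ?ltr0n // mulrAC ltr_pdivlMr ?ltr0n //.
by rewrite -!natrM ltr_nat.
Qed.

(** [r] times the angle is an odd multiple of $\pi/2$, where the cosine vanishes. *)
Lemma typeA_root (k r : nat) : (2 * k + 1 < r)%N ->
  root (typeA_polyR R r) (ntan2 (fracn (2 * k + 1) r)).
Proof.
move=> kr; have /andP[v0 v1] := fracn_itvW kr.
have c0 : cos (pi / 2 * fracn (2 * k + 1) r) != 0.
  by rewrite gt_eqF // cos_halfpi_gt0 // v1 andbT; lra.
apply/rootP; rewrite /ntan2 horner_typeA_polyR //.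
have -> : r%:R * (pi / 2 * fracn (2 * k + 1) r) = (2 * k + 1)%:R * (pi / 2).
  by rewrite /fracn; field; rewrite pnatr_eq0 -lt0n; lia.
by rewrite cos_odd_halfpi mul0r.
Qed.

Lemma size_typeA_polyR r : size (typeA_polyR R r) = (r./2).+1.
Proof.
rewrite /typeA_polyR size_map_poly_id0 ?intr_eq0 ?lead_coef_eq0; last first.
  apply: contraTneq (ltn0Sn r) => /polyP/(_ 0%N).
  by rewrite typeA_poly_bin_even coef_bin_even muln0 bin0 coef0.
rewrite typeA_poly_bin_even; apply/eqP; rewrite eqn_leq; apply/andP; split.
  apply/leq_sizeP => j hj; rewrite coef_bin_even bin_small //; lia.
rewrite ltnNge; apply/negP => /leq_sizeP/(_ _ (leqnn _))/eqP.
by rewrite coef_bin_even pnatr_eq0 -leqn0 leqNgt bin_gt0; lia.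
Qed.

(* Listed in increasing order, hence with decreasing angles. *)
Definition typeA_zeros r : seq R :=
  mkseq (fun i => ntan2 (fracn (2 * (r./2 - i.+1) + 1) r)) r./2.

Lemma sorted_typeA_zeros r : sorted <%R (typeA_zeros r).
Proof.
apply/(sortedP 0) => i; rewrite size_mkseq => ir.
rewrite !nth_mkseq ?(ltnW ir) //; apply: ntan2_lt.
- by apply: divr_ge0; exact: ler0n.
- by rewrite fracn_lt; nia.
- by have /andP[] : 0 <= fracn (2 * (r./2 - i.+1) + 1) r < 1 by apply: fracn_itvW; lia.
Qed.

(** The listed roots are distinct and as many as the degree, so there are no others. *)
Lemma typeA_polyR_prod r : typeA_polyR R r =
  lead_coef (typeA_polyR R r) *: \prod_(z <- typeA_zeros r) ('X - z%:P).
Proof.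
apply: all_roots_prod_XsubC; first by rewrite size_typeA_polyR size_mkseq.
  apply/allP => x /mapP[i]; rewrite mem_iota => /andP[_]; rewrite add0n => ir ->.
  by apply: typeA_root; lia.
by rewrite uniq_rootsE; apply: lt_sorted_uniq; exact: sorted_typeA_zeros.
Qed.

Lemma typeA_polyR_neq0 r : typeA_polyR R r != 0.
Proof. by rewrite -size_poly_eq0 size_typeA_polyR. Qed.

Lemma root_typeA_polyR r x : root (typeA_polyR R r) x = (x \in typeA_zeros r).
Proof.
by rewrite typeA_polyR_prod rootZ ?lead_coef_eq0 ?typeA_polyR_neq0 // root_prod_XsubC.
Qed.

(** Two strictly increasing lists with the same members coincide; this fixes the numbering of the
    zeros. *)
Lemma rootsR_typeA r : rootsR (typeA_polyR R r) = typeA_zeros r.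
Proof.
apply: lt_sorted_eq; [exact: sorted_roots|exact: sorted_typeA_zeros|].
move=> x; rewrite -root_typeA_polyR.
by have /roots_onP/(_ x) := roots_on_rootsR (typeA_polyR_neq0 r) => ->.
Qed.

(** The index [j] counts from 1 at the most negative zero, which has the largest fraction;
    [j = r./2] gives the fraction $1/r$. *)
Lemma xiE r j : (0 < j <= r./2)%N ->
  xi R r j = ntan2 (fracn (2 * (r./2 - j) + 1) r).
Proof.
move=> /andP[j0 jr]; rewrite /xi rootsR_typeA nth_mkseq prednK //.
Qed.

Lemma typeA_zerosP r : (2 <= r)%N ->
  [/\ size (rootsR (typeA_polyR R r)) = r./2,
      forall x, x \in rootsR (typeA_polyR R r) -> x < 0 &
      typeA_polyR R r = lead_coef (typeA_polyR R r)
        *: \prod_(1 <= j < (r./2).+1) ('X - (xi R r j)%:P)].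
Proof.
move=> r2; rewrite rootsR_typeA; split; first by rewrite size_mkseq.
  move=> x /mapP[i]; rewrite mem_iota => /andP[_]; rewrite add0n => ir ->.
  by apply/ntan2_lt0/fracn_itv; lia.
rewrite {1}typeA_polyR_prod; congr (_ *: _).
rewrite big_map [RHS]big_add1 /= /index_iota subn0.
by apply: eq_big_seq => i; rewrite mem_iota add0n => /andP[_ ir]; rewrite xiE.
Qed.

End Zeros.

(** * Interlacing of consecutive polynomials *)

Section Interlacing.
Variable R : realType.
Implicit Types (r : nat) (a b c x : R).
Local Notation g := (@ntan2 R).
Local Notation fracn := (fracn R).

Lemma negative_zerosP r x :
  negative_zeros (typeA_polyR R r) x <->
  exists2 k, (2 * k + 1 < r)%N & x = g (fracn (2 * k + 1) r).
Proof.
split=> [[_]|[k kr ->]].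
  rewrite root_typeA_polyR => /mapP[i]; rewrite mem_iota add0n => /andP[_ ir] ->.
  by exists (r./2 - i.+1)%N => //; lia.
by split; [apply/ntan2_lt0/fracn_itv; lia | exact: typeA_root].
Qed.

(** Since [ntan2] reverses the order, comparing zeros amounts to comparing products of integers. *)
Lemma ntan2_fracn_lt (m n r s : nat) : (m < r)%N -> (n < s)%N ->
  (g (fracn m r) < g (fracn n s)) = (n * r < m * s)%N.
Proof.
move=> mr ns; rewrite ntan2_ltE ?fracn_itvW // fracn_lt //.
  exact: leq_ltn_trans ns.
exact: leq_ltn_trans mr.
Qed.

Lemma consecutive_zeros r a b :
  consecutive (negative_zeros (typeA_polyR R r)) a b ->
  exists l, [/\ (2 * l + 3 < r)%N, a = g (fracn (2 * l + 3) r)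
    & b = g (fracn (2 * l + 1) r)].
Proof.
move=> [/negative_zerosP[k kr ->] /negative_zerosP[l lr ->]].
rewrite ntan2_fracn_lt // => lk gap.
have e : (2 * k + 1 = 2 * l + 3)%N.
  apply/eqP; apply/negPn/negP => ne.
  have lr3 : (2 * l + 3 < r)%N by nia.
  (* Otherwise the next odd numerator $2l+3$ yields a zero inside the gap. *)
  apply: (gap (g (fracn (2 * l.+1 + 1) r))).
    by rewrite !ntan2_fracn_lt //; nia.
  by apply/negative_zerosP; exists l.+1 => //; nia.
by exists l; rewrite -e.
Qed.

(** In terms of fractions, $(2l+1)/(r+1) < (2l+1)/r < (2l+3)/(r+1) < (2l+3)/r$ in the range that
    occurs. *)
Lemma typeA_interlace r :
  strictly_interlace (negative_zeros (typeA_polyR R r))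
                     (negative_zeros (typeA_polyR R r.+1)).
Proof.
split.
(* A common zero would give $(2k+1)(r+1) = (2l+1)r$, so $r$ would divide $2k+1$, which lies strictly
   between 0 and $r$. *)
- rewrite -subset0 => x [/negative_zerosP[k kr ->] /negative_zerosP[l lr]] e.
  have := ntan2_fracn_lt kr lr; have := ntan2_fracn_lt lr kr.
  by rewrite e ltxx; nia.
- move=> _ _ /consecutive_zeros[l [lr -> ->]].
  exists (g (fracn (2 * l.+1 + 1) r.+1)); split.
    split; first by rewrite !ntan2_fracn_lt; nia.
    by apply/negative_zerosP; exists l.+1 => //; nia.
  move=> c [ab /negative_zerosP[m mr e]]; move: ab; rewrite e !ntan2_fracn_lt; try lia.
  (* The bounds give $2l+1 < 2m+1 < 2l+4$, because $2l+3 < r$. *)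
  by move=> /andP[h1 h2]; have -> : m = l.+1 by nia.
- move=> _ _ /consecutive_zeros[l [lr -> ->]].
  exists (g (fracn (2 * l + 1) r)); split.
    split; first by rewrite !ntan2_fracn_lt; nia.
    by apply/negative_zerosP; exists l => //; nia.
  move=> c [ab /negative_zerosP[m mr e]]; move: ab; rewrite e !ntan2_fracn_lt; try lia.
  by move=> /andP[h1 h2]; have -> : m = l by nia.
Qed.

End Interlacing.

(** * Quantiles of the zeros *)

Section Quantiles.
Variable R : realType.
Implicit Types (r : nat) (u v : R).

Lemma ntan2_continuous v : -1 < v < 1 -> {for v, continuous (@ntan2 R)}.
Proof.
move=> v1; apply: cvgN; rewrite /= expr2; under eq_fun do rewrite expr2.
have tc : tan (pi / 2 * w) @[w --> v] --> tan (pi / 2 * v).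
  apply: continuous_cvg; last by apply: cvgMr; exact: cvg_id.
  by apply: continuous_tan; rewrite gt_eqF // cos_halfpi_gt0.
exact: cvgM.
Qed.

Lemma cvg_inv_nat : (r%:R^-1 : R) @[r --> \oo] --> (0 : R).
Proof.
apply/gtr0_cvgV0; last exact: cvgr_idn.
by exists 1%N => // r /=; rewrite ltr0n.
Qed.

Lemma cvg_half_fracn : fracn R r./2 r @[r --> \oo] --> (2^-1 : R).
Proof.
have inv0 := cvg_inv_nat.
apply: (@squeeze_cvgr _ _ _ _ (fun r => 2^-1 - r%:R^-1) (fun=> 2^-1)).
- exists 1%N => // r /= r0; have r0' : 0 < r%:R :> R by rewrite ltr0n.
  rewrite /fracn ler_pdivlMr // ler_pdivrMr // mulrBl mulVf ?gt_eqF //.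
  have : (r%:R <= (2 * r./2 + 1)%:R :> R) && ((2 * r./2)%:R <= r%:R :> R).
    by rewrite !ler_nat; lia.
  by rewrite natrD natrM; lra.
- by rewrite -[X in _ --> X]subr0; apply: cvgB => //; exact: cvg_cst.
- exact: cvg_cst.
Qed.

(** Increasing zeros have decreasing angles, so the quantile $u$ sits at $v = 1 - u$, and the
    complementary angle turns the tangent into a cotangent. *)
Lemma ntan2_compl u : ntan2 (1 - u) = - cot (pi * u / 2%:R) ^+ 2.
Proof.
rewrite /ntan2 /tan /cot.
have -> : pi / 2 * (1 - u) = - (pi * u / 2 - pi / 2) by field.
by rewrite sinN cosN sinBpihalf cosBpihalf opprK.
Qed.

Lemma typeA_quantile u (j : nat -> nat) : 0 < u < 1 ->
  (forall r, (2 <= r)%N -> (1 <= j r <= r./2)%N) ->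
  (j r)%:R / (r./2)%:R @[r --> \oo] --> u ->
  xi R r (j r) @[r --> \oo] --> - cot (pi * u / 2%:R) ^+ 2.
Proof.
move=> u01 jr ju; rewrite -ntan2_compl.
have inv0 := cvg_inv_nat.
have H : fracn R (2 * (r./2 - j r) + 1) r @[r --> \oo] --> 1 - u.
  (* With $d = \lfloor r/2 \rfloor$, the fraction equals $2 (d/r)(1 - j_r/d) + 1/r$. *)
  have L : 2 * fracn R r./2 r * (1 - (j r)%:R / (r./2)%:R) + r%:R^-1
      @[r --> \oo] --> 2 * 2^-1 * (1 - u) + 0.
    apply: cvgD => //; apply: cvgM; last by apply: cvgB => //; exact: cvg_cst.
    by apply: cvgM; [exact: cvg_cst | exact: cvg_half_fracn].
  rewrite mulfV // mul1r addr0 in L.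
  apply: cvg_trans L; apply: near_eq_cvg; exists 2%N => // r /= r2.
  have /andP[j0 jd] := jr r r2.
  rewrite /fracn natrD natrM natrB //.
  by field; rewrite !pnatr_eq0; apply/andP; split; lia.
apply: (@cvg_trans _ (ntan2 (fracn R (2 * (r./2 - j r) + 1) r) @[r --> \oo])).
  by apply: near_eq_cvg; exists 2%N => // r /= r2; rewrite xiE // jr.
apply: continuous_cvg => //; apply: ntan2_continuous.
by move: u01 => /andP[? ?]; lra.
Qed.

End Quantiles.

(** * The limit distribution of the zeros *)

Section MidpointSum.
Variable R : realType.
Implicit Types (h F : R -> R) (x y : R) (r k : nat).

(** Heine's theorem by compactness. Continuity is two-sided at the endpoints, so [y] may leave
    $[a, b]$. *)
Lemma uniform_continuity h (a b : R) :
  (forall x, a <= x <= b -> {for x, continuous h}) ->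
  forall e : R, 0 < e -> exists2 d : R, 0 < d &
    forall x y, a <= x <= b -> `|x - y| < d -> `|h x - h y| < e.
Proof.
move=> hc e e0; have e2 : 0 < e / 2 by rewrite divr_gt0.
have cov := (@compact_near_coveringP _ `[a, b]).1 (@segment_compact R a b).
have H : \forall d \near 0^'+, `[a, b] `<=`
    (fun x => forall y, `|x - y| < d -> `|h x - h y| < e).
  apply: cov => x /= xab.
  have {}xab : a <= x <= b by move: xab; rewrite in_itv.
  have /cvgrPdist_lt/(_ _ e2)/nbhs_ballP[n /= n0 hn] := hc x xab.
  have n2 : 0 < n / 2 by rewrite divr_gt0.
  (* Half the radius, so that [z] and every [y] within [d] of it stay in the ball of radius [n]
     around [x]. *)
  exists (ball x (n / 2), [set d : R | d < n / 2]).
    by split; [exact: nbhsx_ballx | exact: nbhs_right_lt].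
  move=> [z d] /= [xz dn] y zy.
  have hz : `|h x - h z| < e / 2.
    by apply: hn; apply: lt_le_trans xz _; rewrite ler_pdivrMr //; lra.
  have hy : `|h x - h y| < e / 2.
    apply: hn; rewrite /ball /= -(subrKA z).
    apply: (le_lt_trans (ler_normD _ _)).
    have := xz; rewrite /ball /= => xz'; lra.
  rewrite -(subrKA (h x)); apply: (le_lt_trans (ler_normD _ _)).
  by rewrite (distrC (h z)); lra.
near (0 : R)^'+ => d; exists d; first by near: d; exact: nbhs_right_gt.
move=> x y xab xy; suff Hd : `[a, b] `<=`
    (fun x => forall y, `|x - y| < d -> `|h x - h y| < e).
  by apply: Hd => //=; rewrite in_itv.
by near: d.
Unshelve. all: by end_near. Qed.

(* Mean value theorem on each interval between consecutive midpoints. *)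
Lemma midpoint_sum_error h F (e d : R) r :
  (forall x, 0 < x < 1 -> is_derive x 1 F (h x)) ->
  (forall x y, 0 <= x <= 1 -> `|x - y| < d -> `|h x - h y| < e) ->
  (2 <= r)%N -> 2 / r%:R < d ->
  `| 2 / r%:R * \sum_(k < (r./2).-1) h (fracn R (2 * k + 1) r)
     - (F (fracn R (2 * (r./2).-1 + 1) r) - F (fracn R 1 r)) | <= e.
Proof.
move=> dF hu r2 rd.
have r0 : 0 < r%:R :> R by rewrite ltr0n; lia.
pose v k := fracn R (2 * k + 1) r.
have vS k : v k.+1 - v k = 2 / r%:R.
  by rewrite /v /fracn -mulrBl -natrB; [congr (_%:R / _); lia | lia].
have -> : F (fracn R (2 * (r./2).-1 + 1) r) - F (fracn R 1 r) =
    \sum_(k < (r./2).-1) (F (v k.+1) - F (v k)).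
  by rewrite -(big_mkord xpredT (fun k => F (v k.+1) - F (v k))) telescope_sumr.
rewrite mulr_sumr -sumrB; apply: (le_trans (ler_norm_sum _ _ _)).
have step (k : 'I_(r./2).-1) : true ->
    `|2 / r%:R * h (v k) - (F (v k.+1) - F (v k))| <= 2 / r%:R * e.
  move=> _; have kd : (k < (r./2).-1)%N by [].
  have /andP[v0 _] : 0 < v k < 1 by apply: fracn_itv; lia.
  have /andP[_ v1] : 0 < v k.+1 < 1 by apply: fracn_itv; lia.
  have vlt : v k < v k.+1 by rewrite -subr_gt0 vS divr_gt0.
  have dF' x : x \in `[v k, v k.+1] -> is_derive x 1 F (h x).
    by rewrite in_itv /= => /andP[? ?]; apply: dF; lra.
  have [|c] := @MVT R F h (v k) (v k.+1) vlt (fun x xI => dF' x (subset_itv_oo_cc xI)).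
    by apply: derivable_within_continuous => x /dF' [].
  rewrite in_itv /= => /andP[vc cv] ->; rewrite vS (mulrC (h c)) -mulrBr.
  rewrite normrM (gtr0_norm (divr_gt0 _ r0)) // ler_pM2l ?divr_gt0 // ltW //.
  apply: hu; first by lra.
  rewrite distrC gtr0_norm ?subr_gt0 //; apply: lt_trans rd.
  by rewrite -(vS k) ltrD2r.
apply: (le_trans (ler_sum _ step)); rewrite sumr_const card_ord -[leLHS]mulr_natl.
(* Positivity of [e] is read off from [hu] at $x = y = 0$. *)
have e0 : 0 < e.
  have := hu 0 0; rewrite !subrr !normr0 lexx ler01; apply => //.
  by apply: lt_trans rd; rewrite divr_gt0.
(* The intervals, each of length $2/r$, have total length at most 1. *)
rewrite mulrA ler_piMl ?(ltW e0) //.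
rewrite mulrA -natrM ler_pdivrMr // mul1r ler_nat; lia.
Qed.

(** [F] is differentiated only inside $(0, 1)$, so the error bound runs from the first node to the
    last; continuity of [F] at 0 and 1 does the rest. *)
Lemma cvg_midpoint_sum h F :
  (forall x, 0 <= x <= 1 -> {for x, continuous h}) ->
  (forall x, 0 < x < 1 -> is_derive x 1 F (h x)) ->
  {for 0, continuous F} -> {for 1, continuous F} ->
  (r./2)%:R^-1 * \sum_(k < r./2) h (fracn R (2 * k + 1) r) @[r --> \oo]
    --> F 1 - F 0.
Proof.
move=> hc dF F0 F1.
have first0 : fracn R 1 r @[r --> \oo] --> (0 : R).
  by rewrite /fracn; under eq_fun do rewrite mul1r; exact: cvg_inv_nat.
have last1 : fracn R (2 * (r./2).-1 + 1) r @[r --> \oo] --> (1 : R).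
  have L : 2 * fracn R r./2 r - r%:R^-1 @[r --> \oo] --> 2 * 2^-1 - (0 : R).
    apply: cvgB; last exact: cvg_inv_nat.
    by apply: cvgM; [exact: cvg_cst | exact: cvg_half_fracn].
  rewrite mulfV // subr0 in L; apply: cvg_trans L; apply: near_eq_cvg.
  exists 2%N => // r /= r2; rewrite /fracn.
  have -> : (2 * (r./2).-1 + 1 = 2 * r./2 - 1)%N by lia.
  rewrite natrB ?natrM; last lia.
  by field; rewrite pnatr_eq0; lia.
pose S r := 2 / r%:R * \sum_(k < (r./2).-1) h (fracn R (2 * k + 1) r).
have two0 : 2 / r%:R @[r --> \oo] --> (0 : R).
  by rewrite -(mulr0 2); apply: cvgM; [exact: cvg_cst | exact: cvg_inv_nat].
have SF : S r - (F (fracn R (2 * (r./2).-1 + 1) r) - F (fracn R 1 r))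
    @[r --> \oo] --> 0.
  apply/cvgr0Pnorm_le => e e0.
  have [d d0 hd] := uniform_continuity hc e0.
  near=> r; apply: (@midpoint_sum_error h F e d r dF hd).
    by near: r; exists 2%N.
  by near: r; apply: (cvgr_lt _ two0).
have cS : S r @[r --> \oo] --> F 1 - F 0.
  have cF : F (fracn R (2 * (r./2).-1 + 1) r) - F (fracn R 1 r) @[r --> \oo]
      --> F 1 - F 0.
    apply: cvgB; first exact: (continuous_cvg _ F1 last1).
    exact: (continuous_cvg _ F0 first0).
  have L := cvgD SF cF; rewrite add0r in L.
  apply: (cvg_trans _ (L _)); apply: near_eq_cvg.
  by apply: nearW => r /=; rewrite fctE /= subrK.
(* The last node starts no interval; its term has weight $2/r$ and vanishes in the limit. *)
have clast : 2 / r%:R * h (fracn R (2 * (r./2).-1 + 1) r) @[r --> \oo] --> (0 : R).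
  rewrite -(mul0r (h 1)); apply: cvgM => //.
  have h1 : {for 1, continuous h} by apply: hc; rewrite ler01 lexx.
  exact: (continuous_cvg _ h1 last1).
(* This factor trades the weight $2/r$ for $1/\lfloor r/2 \rfloor$. *)
have cinv : (2 * fracn R r./2 r)^-1 @[r --> \oo] --> (1^-1 : R).
  have L : 2 * fracn R r./2 r @[r --> \oo] --> 2 * (2^-1 : R).
    by apply: cvgM; [exact: cvg_cst | exact: cvg_half_fracn].
  by rewrite mulfV // in L; apply: cvgV.
rewrite invr1 in cinv.
have L : (2 * fracn R r./2 r)^-1 *
    (S r + 2 / r%:R * h (fracn R (2 * (r./2).-1 + 1) r)) @[r --> \oo]
    --> 1 * (F 1 - F 0 + 0) by apply: cvgM => //; exact: cvgD.
rewrite mul1r addr0 in L; apply: (cvg_trans _ L); apply: near_eq_cvg; exists 2%N => // r /= r2.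
have -> : (r./2 = (r./2).-1.+1)%N by lia.
rewrite big_ord_recr /= /S /fracn.
set A := \sum_(_ < _) _; set B := h _.
by field; rewrite addrC natr1 !pnatr_eq0; lia.
Unshelve. all: by end_near. Qed.

End MidpointSum.

(** * Weak convergence to the limit density *)

Section WeakLimit.
Variables (R : realType) (f : R -> R).
Hypothesis fC : continuous_compact_support `]-oo, 0[ f.
Local Notation mu := (@lebesgue_measure R).
Implicit Types (t u v x : R).

(** A compact subset of $(-\infty, 0)$ is bounded and, being closed, stays away from 0. *)
Lemma compact_support_bounds : exists b B : R,
  0 < b /\ forall t, t < 0 -> ~~ (- B <= t <= - b) -> f t = 0.
Proof.
have [_ [K [Kcompact Ksub K0]]] := fC.
have [M [_ HM]] := compact_bounded Kcompact.
have Kclosed := compact_closed (@Rhausdorff R) Kcompact.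
have nK0 : ~ K 0 by move=> /Ksub /=; rewrite in_itv /= ltxx.
have : nbhs (0 : R) (~` K) by apply: open_nbhs_nbhs; split => //; exact: closed_openC.
case/nbhs_ballP => b /= b0 hb; exists b, (M + 1); split=> // t t0 tbB.
apply: K0 => [|Kt]; first by rewrite /= in_itv.
move: tbB; rewrite negb_and -!ltNge => /orP[tB|tb].
  have M1 : M < M + 1 by rewrite ltrDl.
  by have := HM _ M1 t Kt; rewrite /= ltr0_norm //; lra.
by apply: (hb t) => //; rewrite /ball /= sub0r normrN ltr0_norm //; lra.
Qed.

(** [f] is arbitrary on $[0, \infty)$; extension by zero from the negative half-line is continuous
    because the support avoids 0. *)
Definition cutf t : R := if t < 0 then f t else 0.
Definition density t : R := cutf t / (Num.sqrt (- t) * (1 - t)).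

Lemma cutf0 (b B : R) : 0 < b ->
  (forall t, t < 0 -> ~~ (- B <= t <= - b) -> f t = 0) ->
  forall t, ~~ (- B <= t <= - b) -> cutf t = 0.
Proof. by move=> b0 h t ht; rewrite /cutf; case: ifP => // t0; exact: h. Qed.

Lemma cutf_near0 t : 0 <= t -> \forall s \near t, cutf s = 0.
Proof.
have [b [B [b0 /(cutf0 b0) h]]] := compact_support_bounds.
move=> t0; near=> s; apply: h; rewrite negb_and -!ltNge; apply/orP; right.
by near: s; apply: lt_nbhsr; lra.
Unshelve. all: by end_near. Qed.

Lemma cutf_continuous : continuous cutf.
Proof.
move=> t; have [t0|t0] := ltP t 0.
  have ft : {for t, continuous f}.
    have [+ _] := fC; rewrite continuous_open_subspace; last exact: interval_open.
    by apply; rewrite inE /= in_itv.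
  rewrite /continuous_at {2}/cutf t0; apply: cvg_trans ft.
  apply: near_eq_cvg; near=> s; rewrite /cutf ifT //.
  by near: s; exact: lt_nbhsl.
have c0 : cutf t = 0 by rewrite /cutf ltNge t0.
by rewrite /continuous_at c0; apply: cvg_near_cst; exact: cutf_near0.
Unshelve. all: by end_near. Qed.

Lemma density_continuous : continuous density.
Proof.
move=> t; have [t0|t0] := ltP t 0.
  apply: cvgM; first exact: cutf_continuous.
  apply: cvgV.
    by rewrite mulf_neq0 // gt_eqF // ?sqrtr_gt0; lra.
  apply: cvgM; last by apply: cvgB; [exact: cvg_cst | exact: cvg_id].
  apply: continuous_cvg; first exact: sqrt_continuous.
  by apply: cvgN; exact: cvg_id.
have c0 : density t = 0 by rewrite /density /cutf ltNge t0 mul0r.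
rewrite /continuous_at c0; apply: cvg_near_cst; near=> s; rewrite /density.
have -> : cutf s = 0 by near: s; exact: cutf_near0.
by rewrite mul0r.
Unshelve. all: by end_near. Qed.

(** The function is continuous and vanishes outside a compact segment. *)
Lemma density_integrable : mu.-integrable setT (EFin \o density).
Proof.
have [b [B [b0 /(cutf0 b0) h]]] := compact_support_bounds.
have -> : EFin \o density = (EFin \o density) \_ `[- B, - b].
  apply/funext => t; rewrite patchE; case: ifPn => //.
  rewrite notin_setE /= in_itv /= => /negP tbB.
  by rewrite /density h // mul0r.
have mI : measurable (`[- B, - b] : set R) by exact: measurable_itv.
have [+ _] := integrable_mkcond (mu := mu) (EFin \o density) mI; apply.
apply: continuous_compact_integrable; first exact: segment_compact.
by apply: continuous_subspaceT; exact: density_continuous.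
Qed.

(** The antiderivative of [density] that vanishes near $-\infty$; its value at 0 is the limit
    integral. *)
Definition cumul x : R := \int[mu]_(t in `]-oo, x]) density t.

Lemma is_derive_cumul x : is_derive x 1 cumul (density x).
Proof.
have xu : x < x + 1 by rewrite ltrDl.
have di : mu.-integrable `]-oo, x + 1] (EFin \o density).
  by apply: integrableS density_integrable => //; exact: measurable_itv.
have [dx <-] := continuous_FTC1 xu di (ltNyr _) (@density_continuous x).
by rewrite derive1E; exact: DeriveDef.
Qed.

Lemma cumul0E : cumul 0 =
  \int[mu]_(t in `]-oo, 0[) (f t / (Num.sqrt (- t) * (1 - t))).
Proof.
rewrite /cumul -Rintegral_itv_bndo_bndc.
  by apply: eq_Rintegral => t; rewrite inE /= in_itv /= /density /cutf => ->.
by apply: integrableS density_integrable => //; exact: measurable_itv.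
Qed.

Lemma is_derive_ntan2 v : -1 < v < 1 -> is_derive v 1 (@ntan2 R)
  (- (pi * tan (pi / 2 * v) * (1 + tan (pi / 2 * v) ^+ 2))).
Proof.
move=> v1; have c0 : cos (pi / 2 * v) != 0 by rewrite gt_eqF // cos_halfpi_gt0.
have dl : is_derive v 1 (fun v : R => pi / 2 * v) (pi / 2).
  by apply: is_derive_eq; rewrite /GRing.scale /= mulr1.
have dt := is_derive1_comp (is_derive_tan c0) dl.
have -> : @ntan2 R = - ((tan \o (fun v : R => pi / 2 * v)) ^+ 2).
  by apply/funext => w; rewrite /ntan2 !fctE.
apply: is_derive_eq.
by rewrite cos2_tan2 // /GRing.scale /= expr1 -mulr_natl; field.
Qed.

(** As $v$ tends to 1 from below, [ntan2 v] passes to the left of the support. *)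
Lemma cutf_ntan2_near1 : \forall v \near (1 : R), v < 1 ->
  cumul (ntan2 v) = 0 /\ cutf (ntan2 v) = 0.
Proof.
have [b [B [b0 /(cutf0 b0) h]]] := compact_support_bounds.
(* Chosen so that [ntan2 v0] is $-(|B|+1)^2$, which is less than $-B$. *)
pose v0 := 2 / pi * atan (`|B| + 1).
have pi0 : pi != 0 :> R by rewrite gt_eqF ?pi_gt0.
have v01 : v0 < 1.
  rewrite /v0 mulrAC ltr_pdivrMr ?pi_gt0 // mul1r -ltr_pdivlMl //.
  by rewrite mulrC; exact: atan_ltpi2.
have v00 : 0 < v0.
  by rewrite mulr_gt0 ?divr_gt0 ?pi_gt0 // -(atan0 R) lt_atan // ltr_wpDl.
have far v t : v0 < v -> v < 1 -> t <= ntan2 v -> cutf t = 0.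
  move=> vv v1 tv; apply: h; rewrite negb_and -ltNge; apply/orP; left.
  apply: (le_lt_trans tv); apply: (lt_trans (ntan2_lt (ltW v00) vv v1)).
  rewrite /ntan2 /v0 mulrA (_ : pi / 2 * (2 / pi) = 1) ?mul1r; last first.
    by rewrite -mulrA mulKf ?divff.
  rewrite atanK ltrN2; have := ler_norm B; have := normr_ge0 B; nra.
near=> v; move=> v1; have vv : v0 < v by near: v; exact: lt_nbhsr.
split; last exact: far vv v1 (lexx _).
transitivity (\int[mu]_(t in `]-oo, ntan2 v]) (0 : R)); last first.
  by rewrite Rintegral_cst ?mul0r //; exact: measurable_itv.
apply: eq_Rintegral => t; rewrite inE /= in_itv /= => tv.
by rewrite /density (far v) // mul0r.
Unshelve. all: by end_near. Qed.

(** With $s = \tan(\pi v/2)$, the density at $-s^2$ is $f(-s^2)/(s(1+s^2))$ and $-s^2$ has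
    derivative $-\pi s(1+s^2)$ in $v$. These cancel, so $-\pi^{-1}$ times [cumul (ntan2 v)] is an
    antiderivative of $f(-s^2)$ on $(0, 1)$. *)
Lemma typeA_weak_limit :
  (r./2)%:R^-1 * \sum_(1 <= j < (r./2).+1) f (xi R r j) @[r --> \oo] -->
    pi^-1 * \int[mu]_(t in `]-oo, 0[) (f t / (Num.sqrt (- t) * (1 - t))).
Proof.
rewrite -cumul0E.
(* [ntan2 1] is a junk value, hence the truncations at 1. *)
pose h v := if v < 1 then cutf (ntan2 v) else 0.
pose F v := if v < 1 then - pi^-1 * cumul (ntan2 v) else 0.
have pi0 : pi != 0 :> R by rewrite gt_eqF ?pi_gt0.
have cumulC : continuous cumul.
  move=> x; apply/differentiable_continuous/derivable1_diffP.
  by have [] := is_derive_cumul x.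
have hC x : 0 <= x <= 1 -> {for x, continuous h}.
  move=> /andP[x0]; rewrite le_eqVlt => /predU1P[->|x1].
    have h1 : h 1 = 0 by rewrite /h ltxx.
    suff : h v @[v --> (1 : R)] --> h 1 by [].
    rewrite h1; apply: cvg_near_cst; near=> v; rewrite /h.
    case: ifP => // v1; have [] // : cumul (ntan2 v) = 0 /\ cutf (ntan2 v) = 0.
    by move: v1; near: v; exact: cutf_ntan2_near1.
  have xx : {for x, continuous (cutf \o @ntan2 R)}.
    apply: continuous_comp; last exact: cutf_continuous.
    by apply: ntan2_continuous; lra.
  have hx : h x = cutf (ntan2 x) by rewrite /h x1.
  suff : h v @[v --> x] --> h x by [].
  rewrite hx; apply: (cvg_trans _ xx); apply: near_eq_cvg.
  by near=> v; rewrite /h ifT //; near: v; exact: lt_nbhsl.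
have dF x : 0 < x < 1 -> is_derive x 1 F (h x).
  move=> x01; have /andP[x0 x1] := x01.
  have tx : 0 < tan (pi / 2 * x).
    by rewrite -(tan0 R) -[X in tan X](mulr0 (pi / 2)) tan_halfpi_lt //; lra.
  apply: (@near_eq_is_derive _ _ _ (- pi^-1 \*: (cumul \o @ntan2 R))).
    by near=> v; rewrite /F ifT //; near: v; exact: lt_nbhsl.
  have x11 : -1 < x < 1 by lra.
  apply: is_derive_eq.
    apply: is_deriveZ.
    exact: is_derive1_comp (is_derive_cumul _) (is_derive_ntan2 x11).
  rewrite /h x1 /density /ntan2 !opprK sqrtr_sqr gtr0_norm // /GRing.scale /=.
  move: pi0 tx; move: (pi : R) (tan _) => p s p0 s0.
  have s2 : 0 < 1 + s ^+ 2 by nra.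
  by field; rewrite p0 !gt_eqF.
have F0 : {for 0, continuous F}.
  have xx : {for 0, continuous (- pi^-1 \*: (cumul \o @ntan2 R))}.
    apply: cvgZr; apply: continuous_comp; last exact: cumulC.
    by apply: ntan2_continuous; rewrite ltr01 ltrN10.
  have Fx : F 0 = - pi^-1 * cumul (ntan2 0) by rewrite /F ltr01.
  suff : F v @[v --> (0 : R)] --> F 0 by [].
  rewrite Fx; apply: (cvg_trans _ xx); apply: near_eq_cvg.
  by near=> v; rewrite /F ifT //; near: v; apply: lt_nbhsl; exact: ltr01.
have F1 : {for 1, continuous F}.
  have Fx : F 1 = 0 by rewrite /F ltxx.
  suff : F v @[v --> (1 : R)] --> F 1 by [].
  rewrite Fx; apply: cvg_near_cst; near=> v; rewrite /F.
  case: ifP => // v1; have [->] : cumul (ntan2 v) = 0 /\ cutf (ntan2 v) = 0.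
    by move: v1; near: v; exact: cutf_ntan2_near1.
  by rewrite mulr0.
have -> : pi^-1 * cumul 0 = F 1 - F 0.
  by rewrite /F ltxx ltr01 /ntan2 mulr0 tan0 expr0n oppr0 sub0r mulNr opprK.
apply: (cvg_trans _ (cvg_midpoint_sum hC dF F0 F1)).
apply: near_eq_cvg; apply: nearW => r /=.
congr (_ * _); rewrite -(big_mkord xpredT (fun k => h (fracn R (2 * k + 1) r))).
(* The zeros increase while their fractions decrease, hence the reversal. *)
rewrite [RHS]big_add1 /= [RHS]big_nat_rev /= [LHS]big_nat [RHS]big_nat.
apply: eq_bigr => k /andP[_ kd]; rewrite xiE; last lia.
have -> : (r./2 - (0 + r./2 - k.+1).+1 = k)%N by lia.
have k01 : 0 < fracn R (2 * k + 1) r < 1 by apply: fracn_itv; lia.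
by rewrite /h /cutf ntan2_lt0 // ; case/andP: k01 => _ ->.
Unshelve. all: by end_near. Qed.

End WeakLimit.

Theorem corollary5p7 (R : realType) :
  (forall r : nat, (1 <= r)%N ->
     is_qzeta_numerator (@root_rank r) (qzeta_numerator (@root_rank r)) /\
     typeA_poly r = \sum_(0 <= k < (r./2).+1) 'C(r, 2 * k)%:R *: 'X^k)
  /\
  fps_eq_frac typeA_poly (1 - 'X) (1 - 2%:R *: 'X + (1 - 'X) *: 'X^2)
  /\
  typeA_poly 1 = 1 /\ typeA_poly 2 = 1 + 'X
  /\
  (forall r : nat, (2 <= r)%N ->
     typeA_poly r = 2%:R *: typeA_poly (r - 1) - (1 - 'X) * typeA_poly (r - 2))
  /\
  (forall r : nat, (2 <= r)%N ->
     [/\ size (rootsR (typeA_polyR R r)) = r./2,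
         forall x, x \in rootsR (typeA_polyR R r) -> x < 0 &
         typeA_polyR R r = lead_coef (typeA_polyR R r)
           *: \prod_(1 <= j < (r./2).+1) ('X - (xi R r j)%:P)])
  /\
  (forall r : nat, (1 <= r)%N ->
     strictly_interlace (negative_zeros (typeA_polyR R r))
                        (negative_zeros (typeA_polyR R r.+1)))
  /\
  (forall f : R -> R, continuous_compact_support `]-oo, 0[ f ->
     (r./2)%:R^-1 * \sum_(1 <= j < (r./2).+1) f (xi R r j) @[r --> \oo] -->
     pi^-1 * \int[lebesgue_measure]_(t in `]-oo, 0[)
               (f t / (Num.sqrt (- t) * (1 - t))))
  /\
  (forall (u : R) (j : nat -> nat), 0 < u < 1 ->
     (forall r : nat, (2 <= r)%N -> (1 <= j r <= r./2)%N) ->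
     (j r)%:R / (r./2)%:R @[r --> \oo] --> u ->
     xi R r (j r) @[r --> \oo] --> - cot (pi * u / 2%:R) ^+ 2).
Proof.
split; first by move=> r r1; exact: typeA_polyE.
split; first exact: typeA_poly_gf.
split; first exact: typeA_poly1.
split; first exact: typeA_poly2.
split; first by case=> [|[|r]] // _; rewrite !subSS !subn0; exact: typeA_polySS.
split; first by move=> r; exact: typeA_zerosP.
split; first by move=> r _; exact: typeA_interlace.
split; first by move=> f; exact: typeA_weak_limit.
by move=> u j; exact: typeA_quantile.
Qed.
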